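(* Let $G$ be the simply-connected five-dimensional nilpotent Lie group whose Lie algebra $\mathfrak g$ has a basis $e_1,\dots,e_5$ with only non-zero brackets (up to skew-symmetry) $[e_1,e_2]=e_3$, $[e_1,e_3]=-e_5$, $[e_2,e_4]=e_5$, and let $e^1,\dots,e^5$ be the dual basis. Let $M$ be a co-compact quotient of $G$ by a discrete subgroup, to which left-invariant objects descend (a principal $SO(2)$-bundle over a Kodaira surface, with fundamental vector field $e_5$ and connection 1-form $e^5$). Consider on $M$ the generalized contact structure $\mathcal J_1$ determined by the contact 1-form $e^5$, $$F=e_5,\quad \eta=e^5,\quad \pi=e_1\wedge e_3-e_2\wedge e_4,\quad \theta=e^1\wedge e^3-e^2\wedge e^4,\quad \varphi=0,$$ and the generalized contact structure $\mathcal J_0$, $$F=e_5,\quad \eta=e^5,\quad \pi=0,\quad\theta=0,\quad \varphi=e_2\otimes e^1-e_1\otimes e^2+e_4\otimes e^3-e_3\otimes e^4.$$ Then $\mathcal J_1$ and $\mathcal J_0$ are in the same deformation family of generalized contact structures on $M$.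
   Context: Setting: on sections of $TM\oplus T^*M$ put $\langle X+\alpha,Y+\beta\rangle=\frac12(\iota_X\beta+\iota_Y\alpha)$ and the Courant bracket $[\![X+\alpha,Y+\beta]\!]=[X,Y]+\mathcal L_X\beta-\mathcal L_Y\alpha-\frac12 d(\iota_X\beta-\iota_Y\alpha)$, both extended complex-linearly to $(TM\oplus T^*M)_{\mathbb C}$. For a 2-form $\theta$, $\theta^\flat X=\theta(X,\cdot)$; for a bivector field $\pi$, $(\pi^\sharp\alpha)(\beta)=\pi(\alpha,\beta)$; for a $(1,1)$-tensor $\varphi$, $\varphi^*\alpha=\alpha\circ\varphi$. The dual structure equations on $\mathfrak g$ are $de^3=-e^1\wedge e^2$, $de^5=e^1\wedge e^3-e^2\wedge e^4$, $de^1=de^2=de^4=0$. In the tensor $\varphi$, $e_a\otimes e^b$ denotes the endomorphism $X\mapsto e^b(X)e_a$. A generalized almost contact pair on $M$ is a bundle endomorphism $\Phi$ of $TM\oplus T^*M$ together with a section $F+\eta$ ($F$ a vector field, $\eta$ a 1-form) such that $\Phi+\Phi^*=0$ (adjoint with respect to $\langle\cdot,\cdot\rangle$), $\eta(F)=1$, $\Phi(F)=0$, $\Phi(\eta)=0$ and $\Phi\circ\Phi=-\mathbb I+F\odot\eta$, where $(F\odot\eta)(X+\alpha)=\eta(X)F+\alpha(F)\eta$. Two pairs are equivalent if they have the same $\Phi$ and $\eta'=f\eta$, $F'=\frac1fF$ for a nowhere-zero function $f$; a generalized almost contact structure is an equivalence class. In components $\Phi=\begin{pmatrix}\varphi&\pi^\sharp\\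 \theta^\flat&-\varphi^*\end{pmatrix}$, and the structure is denoted $\mathcal J=(F,\eta,\pi,\theta,\varphi)$. Bundles: $\ker\eta\subset TM$ and $\ker F=\{\alpha\in T^*M:\alpha(F)=0\}$; $L_F$ is the complex line bundle spanned by $F$; $E^{(1,0)}=\{e-i\Phi(e): e\in\ker\eta\oplus\ker F\}$; $L=L_F\oplus E^{(1,0)}$. A generalized almost contact structure is a generalized contact structure if $\Gamma(L)$ is closed under the Courant bracket. ''In the same deformation family'' means: both are members of a family $\mathcal J_t$ of generalized contact structures on $M$, depending analytically on a parameter $t$ ranging over a connected parameter space. *)

(* Defs.v *)
From HB Require Import structures.
From mathcomp Require Import all_boot all_order all_algebra.
From mathcomp Require Import generic_quotient ring.
From mathcomp Require Import all_classical all_reals all_analysis.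
Import Order.TTheory GRing.Theory Num.Theory numFieldNormedType.Exports.

Set Implicit Arguments.
Unset Strict Implicit.
Unset Printing Implicit Defensive.

Local Open Scope classical_set_scope.
Local Open Scope ring_scope.
Local Open Scope quotient_scope.

(* Indices of basis vectors run from 1 to 5, as in e_1, ..., e_5. *)
Definition ix (k : nat) : 'I_5 := inord k.-1.
Arguments ix k%_N.

Definition ebasis (R : realType) (k : nat) : 'cV[R]_5 := delta_mx (ix k) 0.
Arguments ebasis R k%_N.

Definition lie_br (R : realType) (x y : 'cV[R]_5) : 'cV[R]_5 :=
  let x_ k := x (ix k) 0 in let y_ k := y (ix k) 0 in
  (x_ 1 * y_ 2 - x_ 2 * y_ 1) *: ebasis R 3
  + ((x_ 2 * y_ 4 - x_ 4 * y_ 2) - (x_ 1 * y_ 3 - x_ 3 * y_ 1)) *: ebasis R 5.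

(* The algebra is 3-step nilpotent, so its simply-connected group is R^5 with
   the Baker-Campbell-Hausdorff product, whose series stops at order 3. *)
Definition bch (R : realType) (x y : 'cV[R]_5) : 'cV[R]_5 :=
  x + y + 2^-1 *: lie_br x y
  + 12^-1 *: (lie_br x (lie_br x y) + lie_br y (lie_br y x)).

Lemma ixE (j k : nat) : (j.-1 < 5)%N -> (k.-1 < 5)%N ->
  (ix j == ix k) = (j.-1 == k.-1).
Proof. by move=> hj hk; rewrite -val_eqE /= !inordK. Qed.

Lemma col5P (R : realType) (x y : 'cV[R]_5) :
  [/\ x (ix 1) 0 = y (ix 1) 0, x (ix 2) 0 = y (ix 2) 0,
      x (ix 3) 0 = y (ix 3) 0, x (ix 4) 0 = y (ix 4) 0
    & x (ix 5) 0 = y (ix 5) 0] -> x = y.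
Proof.
case=> h1 h2 h3 h4 h5; apply/colP => i.
have -> : i = ix i.+1 by rewrite /ix /= inord_val.
by case: i => -[|[|[|[|[|]]]]].
Qed.

Lemma lie_brE (R : realType) (x y : 'cV[R]_5) (z := lie_br x y) :
  [/\ z (ix 1) 0 = 0, z (ix 2) 0 = 0,
      z (ix 3) 0 = x (ix 1) 0 * y (ix 2) 0 - x (ix 2) 0 * y (ix 1) 0,
      z (ix 4) 0 = 0
    & z (ix 5) 0 =
        (x (ix 2) 0 * y (ix 4) 0 - x (ix 4) 0 * y (ix 2) 0)
        - (x (ix 1) 0 * y (ix 3) 0 - x (ix 3) 0 * y (ix 1) 0)].
Proof.
by rewrite {}/z /lie_br; split; rewrite !mxE !ixE //= !(mulr0, mulr1, addr0, add0r).
Qed.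

Lemma bchE (R : realType) (x y : 'cV[R]_5) (z := bch x y)
    (w := x (ix 1) 0 * y (ix 2) 0 - x (ix 2) 0 * y (ix 1) 0) :
  [/\ z (ix 1) 0 = x (ix 1) 0 + y (ix 1) 0,
      z (ix 2) 0 = x (ix 2) 0 + y (ix 2) 0,
      z (ix 3) 0 = x (ix 3) 0 + y (ix 3) 0 + 2^-1 * w,
      z (ix 4) 0 = x (ix 4) 0 + y (ix 4) 0
    & z (ix 5) 0 = x (ix 5) 0 + y (ix 5) 0
      + 2^-1 * ((x (ix 2) 0 * y (ix 4) 0 - x (ix 4) 0 * y (ix 2) 0)
                - (x (ix 1) 0 * y (ix 3) 0 - x (ix 3) 0 * y (ix 1) 0))
      + 12^-1 * (w * (y (ix 1) 0 - x (ix 1) 0))].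
Proof.
have bE k : bch x y (ix k) 0 = x (ix k) 0 + y (ix k) 0
    + 2^-1 * lie_br x y (ix k) 0
    + 12^-1 * (lie_br x (lie_br x y) (ix k) 0 + lie_br y (lie_br y x) (ix k) 0).
  rewrite /bch; move: (lie_br x y) (lie_br y x) => a b.
  by move: (lie_br x a) (lie_br y b) => c d; rewrite !mxE.
have [a1 a2 a3 a4 a5] := lie_brE x y.
have [b1 b2 b3 b4 b5] := lie_brE y x.
have [c1 c2 c3 c4 c5] := lie_brE x (lie_br x y).
have [d1 d2 d3 d4 d5] := lie_brE y (lie_br y x).
rewrite {}/z {}/w.
split; rewrite bE ?(c1, c2, c3, c4, c5, d1, d2, d3, d4, d5)
  ?(a1, a2, a3, a4, a5, b1, b2, b3, b4, b5); ring.
Qed.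

Lemma bchA (R : realType) : associative (@bch R).
Proof.
move=> x y z.
have [a1 a2 a3 a4 a5] := bchE x (bch y z).
have [b1 b2 b3 b4 b5] := bchE (bch x y) z.
have [c1 c2 c3 c4 c5] := bchE x y.
have [d1 d2 d3 d4 d5] := bchE y z.
apply: col5P; split.
- by rewrite a1 b1 c1 d1 addrA.
- by rewrite a2 b2 c2 d2 addrA.
- by rewrite a3 b3 c3 d3 c1 c2 d1 d2; ring.
- by rewrite a4 b4 c4 d4 addrA.
- by rewrite a5 b5 c5 d5 c1 c2 c3 c4 d1 d2 d3 d4; field.
Qed.

Lemma bch0x (R : realType) : left_id 0 (@bch R).
Proof.
move=> x; have [a1 a2 a3 a4 a5] := bchE 0 x.
by apply: col5P; split; rewrite ?(a1, a2, a3, a4, a5) !mxE; ring.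
Qed.

Lemma bchx0 (R : realType) : right_id 0 (@bch R).
Proof.
move=> x; have [a1 a2 a3 a4 a5] := bchE x 0.
by apply: col5P; split; rewrite ?(a1, a2, a3, a4, a5) !mxE; ring.
Qed.

Lemma bchNx (R : realType) : left_inverse 0 -%R (@bch R).
Proof.
move=> x; have [a1 a2 a3 a4 a5] := bchE (- x) x.
by apply: col5P; split; rewrite ?(a1, a2, a3, a4, a5) !mxE; ring.
Qed.

Lemma bchxN (R : realType) : right_inverse 0 -%R (@bch R).
Proof.
move=> x; have [a1 a2 a3 a4 a5] := bchE x (- x).
by apply: col5P; split; rewrite ?(a1, a2, a3, a4, a5) !mxE; ring.
Qed.

Definition nilG (R : realType) : Type := 'cV[R]_5.
HB.instance Definition _ (R : realType) := NormedModule.on (nilG R).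
HB.instance Definition _ (R : realType) := isGroup.Build (nilG R)
  (@bchA R) (@bch0x R) (@bchx0 R) (@bchNx R) (@bchxN R).

(* x and y lie in the same coset Gam x = Gam y. *)
Definition same_coset (R : realType) (Gam : groupClosed (nilG R)) :
  rel (nilG R) := fun x y => (x / y)%g \in Gam.

Lemma same_coset_refl (R : realType) (Gam : groupClosed (nilG R)) :
  reflexive (same_coset Gam).
Proof. by move=> x; rewrite /same_coset divgg gpred1. Qed.

Lemma same_coset_sym (R : realType) (Gam : groupClosed (nilG R)) :
  symmetric (same_coset Gam).
Proof. by move=> x y; rewrite /same_coset -invgF gpredV. Qed.

Lemma same_coset_trans (R : realType) (Gam : groupClosed (nilG R)) :
  transitive (same_coset Gam).
Proof.
move=> y x z xy yz; rewrite /same_coset.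
have -> : (x / z)%g = (x / y * (y / z))%g by rewrite mulgA mulgVK.
exact: gpredM.
Qed.

Canonical same_coset_equiv (R : realType) (Gam : groupClosed (nilG R)) :=
  EquivRel (same_coset Gam) (same_coset_refl Gam) (same_coset_sym Gam)
    (@same_coset_trans R Gam).

Definition nilM (R : realType) (Gam : groupClosed (nilG R)) : Type :=
  quotient_topology {eq_quot same_coset_equiv Gam}.
HB.instance Definition _ (R : realType) (Gam : groupClosed (nilG R)) :=
  Topological.on (nilM Gam).
HB.instance Definition _ (R : realType) (Gam : groupClosed (nilG R)) :=
  Quotient.on (nilM Gam).

Definition discrete_subgroup (R : realType) (Gam : groupClosed (nilG R)) :=
  [set x | x \in Gam] `<=` isolated [set x | x \in Gam].

Definition cocompact_subgroup (R : realType) (Gam : groupClosed (nilG R)) :=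
  compact [set: nilM Gam].

Fixpoint is_Ck (R : realType) (V : normedModType R) (k : nat) (f : V -> R) :
    Prop :=
  if k is k'.+1 then
    (forall x, differentiable f x) /\ forall v : V, is_Ck k' (fun x => 'D_v f x)
  else continuous f.

(* G -> M is a covering: f is smooth on M iff its pullback is smooth on G. *)
Definition smooth (R : realType) (Gam : groupClosed (nilG R))
    (f : nilM Gam -> R) : Prop :=
  forall k : nat, is_Ck k (fun x : nilG R => f (\pi_(nilM Gam) x)).

Definition smooth_mx (R : realType) (Gam : groupClosed (nilG R)) (m n : nat)
    (A : nilM Gam -> 'M[R]_(m, n)) : Prop :=
  forall i j, smooth (fun p => A p i j).

(* TM is trivialized by the left-invariant fields e_1, ..., e_5 and T*M by the
   dual coframe e^1, ..., e^5.  A vector field (resp. a 1-form) is the function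
   X : M -> R^5 of its components in the frame (resp. in the coframe).
   At the coset of x, the vector with components v is the velocity at 0 of
   s |-> Gam (x * s v); this does not depend on the choice of x in the coset. *)
Definition vderiv (R : realType) (Gam : groupClosed (nilG R))
    (X : nilM Gam -> 'cV[R]_5) (f : nilM Gam -> R) : nilM Gam -> R :=
  fun p => 'D_(X p : nilG R)
             (fun y : nilG R => f (\pi_(nilM Gam) (repr p * y)%g)) (0 : nilG R).

Definition frame (R : realType) (Gam : groupClosed (nilG R)) (j : 'I_5) :
  nilM Gam -> 'cV[R]_5 := fun _ => delta_mx j 0.
Arguments frame {R} Gam j p.

(* [X, Y] for X = sum X^i e_i, Y = sum Y^j e_j: the Leibniz rule. *)
Definition vbracket (R : realType) (Gam : groupClosed (nilG R))
    (X Y : nilM Gam -> 'cV[R]_5) : nilM Gam -> 'cV[R]_5 :=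
  fun p => \col_k (vderiv X (fun q => Y q k 0) p - vderiv Y (fun q => X q k 0) p)
           + lie_br (X p) (Y p).

Definition contr (R : realType) (v a : 'cV[R]_5) : R :=
  \sum_(k < 5) v k 0 * a k 0.

Definition ext_d (R : realType) (Gam : groupClosed (nilG R))
    (f : nilM Gam -> R) : nilM Gam -> 'cV[R]_5 :=
  fun p => \col_j vderiv (frame Gam j) f p.

(* (L_X b)(e_j) = X (b (e_j)) - b ([X, e_j]) *)
Definition lie_deriv (R : realType) (Gam : groupClosed (nilG R))
    (X b : nilM Gam -> 'cV[R]_5) : nilM Gam -> 'cV[R]_5 :=
  fun p => \col_j (vderiv X (fun q => b q j 0) p
                   - contr (vbracket X (frame Gam j) p) (b p)).

(* X + a is the stacked column col_mx X a. *)
Definition pairing (R : realType) (u v : 'cV[R]_(5 + 5)) : R :=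
  2^-1 * (contr (usubmx u) (dsubmx v) + contr (usubmx v) (dsubmx u)).

Definition courant (R : realType) (Gam : groupClosed (nilG R))
    (u v : nilM Gam -> 'cV[R]_(5 + 5)) : nilM Gam -> 'cV[R]_(5 + 5) :=
  let X p := usubmx (u p) in let a p := dsubmx (u p) in
  let Y p := usubmx (v p) in let b p := dsubmx (v p) in
  fun p => col_mx (vbracket X Y p)
    (lie_deriv X b p - lie_deriv Y a p
     - 2^-1 *: ext_d (fun q => contr (X q) (b q) - contr (Y q) (a q)) p).

(* A pair (u, v) stands for u + i v, for vectors of the complexified bundle as
   well as for its sections. *)
Definition courantC (R : realType) (Gam : groupClosed (nilG R))
    (s t : nilM Gam -> 'cV[R]_(5 + 5) * 'cV[R]_(5 + 5)) :
    nilM Gam -> 'cV[R]_(5 + 5) * 'cV[R]_(5 + 5) :=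
  let re (w : nilM Gam -> 'cV[R]_(5 + 5) * 'cV[R]_(5 + 5)) p := (w p).1 in
  let im (w : nilM Gam -> 'cV[R]_(5 + 5) * 'cV[R]_(5 + 5)) p := (w p).2 in
  fun p => (courant (re s) (re t) p - courant (im s) (im t) p,
            courant (re s) (im t) p + courant (im s) (re t) p).

Record gac_data (R : realType) (Gam : groupClosed (nilG R)) := GacData {
  gac_Phi : nilM Gam -> 'M[R]_(5 + 5);
  gac_F : nilM Gam -> 'cV[R]_5;
  gac_eta : nilM Gam -> 'cV[R]_5 }.

Definition is_gac_pair (R : realType) (Gam : groupClosed (nilG R))
    (P : gac_data Gam) : Prop :=
  let Phi := gac_Phi P in let F := gac_F P in let eta := gac_eta P in
  [/\ smooth_mx Phi, smooth_mx F & smooth_mx eta] /\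
  forall p,
  [/\ forall u v, pairing (Phi p *m u) v + pairing u (Phi p *m v) = 0,
      contr (F p) (eta p) = 1,
      Phi p *m col_mx (F p) 0 = 0,
      Phi p *m col_mx 0 (eta p) = 0
    & forall u, Phi p *m (Phi p *m u) =
        - u + col_mx (contr (usubmx u) (eta p) *: F p)
                     (contr (F p) (dsubmx u) *: eta p)].

Definition gac_equiv (R : realType) (Gam : groupClosed (nilG R))
    (P Q : gac_data Gam) : Prop :=
  gac_Phi Q = gac_Phi P /\
  exists f : nilM Gam -> R,
    [/\ smooth f, forall p, f p != 0,
        forall p, gac_eta Q p = f p *: gac_eta P p
      & forall p, gac_F Q p = (f p)^-1 *: gac_F P p].

(* A generalized almost contact structure is such a class. *)
Definition gac_class (R : realType) (Gam : groupClosed (nilG R))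
    (P : gac_data Gam) : set (gac_data Gam) :=
  [set Q | is_gac_pair Q /\ gac_equiv P Q].

Definition L_F (R : realType) (Gam : groupClosed (nilG R)) (P : gac_data Gam)
    (p : nilM Gam) : set ('cV[R]_(5 + 5) * 'cV[R]_(5 + 5)) :=
  [set w | exists a b : R,
     w = (col_mx (a *: gac_F P p) 0, col_mx (b *: gac_F P p) 0)].

(* e - i Phi e for e in ker eta + ker F *)
Definition E10 (R : realType) (Gam : groupClosed (nilG R)) (P : gac_data Gam)
    (p : nilM Gam) : set ('cV[R]_(5 + 5) * 'cV[R]_(5 + 5)) :=
  [set w | exists e : 'cV[R]_(5 + 5),
     [/\ contr (usubmx e) (gac_eta P p) = 0, contr (gac_F P p) (dsubmx e) = 0
       & w = (e, - (gac_Phi P p *m e))]].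

Definition L_bundle (R : realType) (Gam : groupClosed (nilG R))
    (P : gac_data Gam) (p : nilM Gam) :
    set ('cV[R]_(5 + 5) * 'cV[R]_(5 + 5)) :=
  [set w | exists w1 w2, [/\ L_F P p w1, E10 P p w2 & w = w1 + w2]].

Definition L_section (R : realType) (Gam : groupClosed (nilG R))
    (P : gac_data Gam)
    (s : nilM Gam -> 'cV[R]_(5 + 5) * 'cV[R]_(5 + 5)) : Prop :=
  [/\ smooth_mx (fun p => (s p).1), smooth_mx (fun p => (s p).2)
    & forall p, L_bundle P p (s p)].

(* L does not depend on the pair chosen in the class. *)
Definition is_gc_structure (R : realType) (Gam : groupClosed (nilG R))
    (J : set (gac_data Gam)) : Prop :=
  exists P, [/\ is_gac_pair P, J = gac_class P
    & forall s t, L_section P s -> L_section P t -> L_section P (courantC s t)].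

(* J = (F, eta, pi, theta, phi).  A bivector and a 2-form are given by their
   matrices pi (e^i, e^j), theta (e_i, e_j); pi^sharp a = pi (a, .) and
   theta^flat X = theta (X, .) are then given by the transposed matrices. *)
Definition gac_of (R : realType) (Gam : groupClosed (nilG R))
    (F eta : 'cV[R]_5) (pi theta phi : 'M[R]_5) : gac_data Gam :=
  GacData (fun _ => block_mx phi pi^T theta^T (- phi^T))
          (fun _ => F) (fun _ => eta).

(* matrix of e_a wedge e_b, or of e^a wedge e^b *)
Definition wedge (R : realType) (a b : nat) : 'M[R]_5 :=
  delta_mx (ix a) (ix b) - delta_mx (ix b) (ix a).
Arguments wedge R (a b)%_N.

(* the endomorphism e_a (x) e^b *)
Definition tens (R : realType) (a b : nat) : 'M[R]_5 := delta_mx (ix a) (ix b).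
Arguments tens R (a b)%_N.

Definition J1 (R : realType) (Gam : groupClosed (nilG R)) :
    set (gac_data Gam) :=
  gac_class (gac_of Gam (ebasis R 5) (ebasis R 5)
    (wedge R 1 3 - wedge R 2 4) (wedge R 1 3 - wedge R 2 4) 0).
Arguments J1 {R} Gam _.

Definition J0 (R : realType) (Gam : groupClosed (nilG R)) :
    set (gac_data Gam) :=
  gac_class (gac_of Gam (ebasis R 5) (ebasis R 5) 0 0
    (tens R 2 1 - tens R 1 2 + tens R 4 3 - tens R 3 4)).
Arguments J0 {R} Gam _.

Definition monom (R : realType) (d : nat) (al : {ffun 'I_d -> nat})
  (s : 'rV[R]_d) : R := \prod_(i < d) s 0 i ^+ al i.

Definition frame_deriv (R : realType) (Gam : groupClosed (nilG R))
    (I : seq 'I_5) (f : nilM Gam -> R) : nilM Gam -> R :=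
  foldr (fun j g => vderiv (frame Gam j) g) f I.

(* f_(t0 + s) = sum_al s^al c_al near t0, with smooth coefficients c_al; the
   series and all its derivatives on M converge absolutely and uniformly. *)
Definition analytic_at (R : realType) (Gam : groupClosed (nilG R)) (d : nat)
    (f : 'rV[R]_d -> nilM Gam -> R) (t0 : 'rV[R]_d) : Prop :=
  exists (c : {ffun 'I_d -> nat} -> nilM Gam -> R) (r : R),
  [/\ 0 < r, forall al, smooth (c al)
    & forall s : 'rV[R]_d, (forall i, `|s 0 i| < r) ->
      (forall I : seq 'I_5, exists b : {ffun 'I_d -> nat} -> R,
         (forall al p, `|frame_deriv I (c al) p| <= b al) /\
         summable [set: {ffun 'I_d -> nat}]
           (fun al => (b al * monom al s)%:E)) /\
      (forall p, (fun N : nat => \sum_(al : {ffun 'I_d -> 'I_N})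
           c [ffun i => al i : nat] p * monom [ffun i => al i : nat] s)
         @ \oo --> f (t0 + s) p)].

Definition analytic_mx_at (R : realType) (Gam : groupClosed (nilG R))
    (d m n : nat) (A : 'rV[R]_d -> nilM Gam -> 'M[R]_(m, n)) (t0 : 'rV[R]_d) :
    Prop :=
  forall i j, analytic_at (fun t p => A t p i j) t0.

(* A family of classes is analytic at t0 if it has an analytic family of
   representatives near t0. *)
Definition analytic_family_at (R : realType) (Gam : groupClosed (nilG R))
    (d : nat) (J : 'rV[R]_d -> set (gac_data Gam)) (t0 : 'rV[R]_d) : Prop :=
  exists P : 'rV[R]_d -> gac_data Gam,
  [/\ \forall t \near t0, is_gac_pair (P t) /\ J t = gac_class (P t),
      analytic_mx_at (fun t => gac_Phi (P t)) t0,
      analytic_mx_at (fun t => gac_F (P t)) t0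
    & analytic_mx_at (fun t => gac_eta (P t)) t0].

(* The parameter space is a connected open subset T of some R^d. *)
Definition same_deformation_family (R : realType) (Gam : groupClosed (nilG R))
    (J J' : set (gac_data Gam)) : Prop :=
  exists (d : nat) (T : set 'rV[R]_d) (Jt : 'rV[R]_d -> set (gac_data Gam)),
  [/\ open T, connected T,
      forall t, T t -> is_gc_structure (Jt t),
      forall t, T t -> analytic_family_at Jt t
    & exists t t', [/\ T t, T t', Jt t = J & Jt t' = J']].

(* Main.v *)
Require Import Defs.
From HB Require Import structures.
From mathcomp Require Import all_boot all_order all_algebra.
From mathcomp Require Import generic_quotient ring.
From mathcomp Require Import all_classical all_reals all_analysis.
Import Order.TTheory GRing.Theory Num.Theory numFieldNormedType.Exports.

Set Implicit Arguments.
Unset Strict Implicit.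
Unset Printing Implicit Defensive.

Local Open Scope classical_set_scope.
Local Open Scope ring_scope.
Local Open Scope quotient_scope.

(**
The two structures are joined by a curve of left-invariant structures that is
polynomial in one real parameter.  On the span of e_1, ..., e_4 write W for
the matrix of e_1 /\ e_3 - e_2 /\ e_4 and J for the complex structure phi of
J_0.  The curve (kodaira_pair) keeps F = e_5 and eta = e^5 and takes
   pi_t = t W,   theta_t = (2 t - t^3) W,   phi_t = (1 - t^2) J,
so that t = 0 gives J_0 and t = 1 gives J_1.  It is found as follows.  On the
Kodaira surface Omega = (e^1 + i e^2) /\ (e^3 + i e^4) is a closed decomposable
2-form, hence c + Omega is a closed pure spinor for each constant c; it has
complex type for c = 0 and symplectic type for c <> 0.  For c <> 0 it equals
c exp (Omega / c).  For c = i one has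
   Omega / c = (e^1 /\ e^4 + e^2 /\ e^3) - i (e^1 /\ e^3 - e^2 /\ e^4),
whose imaginary part is, up to sign, the symplectic form of J_1, while its real
part is closed, hence can be removed by a B-field.  Letting c = i t and taking
the B-field proportional to t, Phi_t is the conjugate of Phi_0 by a
beta-transform and a B-transform, both linear in t.

That each member is a generalized almost contact pair is the identity
(1 - t^2)^2 + t (2 t - t^3) = 1 together with W^2 = J^2 = -1 and W J = - J W
(kodaira_pair_gac).

For the closure under the Courant bracket, the bundle L has constant complex
coefficients in the left-invariant frame (kodaira_LP).  For such a bundle
courantE splits the bracket of two sections u = X + a and v = Y + b into
  - the derivatives D_X v - D_Y u of the components, which stay in L since the
    equations of L are constant (kodaira_L_vderiv);
  - the 1-form with components <D_j u, v> - <u, D_j v> along e_j, which is zero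
    because L is isotropic (kodaira_L_isotropic);
  - the bracket of the constant extensions of the two values, for which L is
    closed by a computation in the Lie algebra (kodaira_L_courant_const).
The bracket of smooth sections is smooth because a vector field with smooth
components acts on smooth functions (smooth_vderiv): by the Taylor expansion
of the group product (nilG_mulE), it is the derivation along a field whose
components are smooth on G (vderivE).

The components of the family are polynomials in t, constant on M, so the family
is analytic in t (analytic_at_poly); the parameter space is the real line.
*)

(** * Functions of class C^k *)

Lemma is_CkS (R : realType) (V : normedModType R) (k : nat) (f : V -> R) :
  is_Ck k.+1 f -> is_Ck k f.
Proof.
elim: k f => [|k IH] f [df Df].
  by move=> x; exact: differentiable_continuous.
by split=> // v; apply: IH; exact: Df.
Qed.

Lemma is_Ck_cst (R : realType) (V : normedModType R) (k : nat) (a : R) :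
  is_Ck k (fun _ : V => a).
Proof.
elim: k a => [|k IH] a; first by move=> x; exact: cst_continuous.
split=> [x|v]; first exact: differentiable_cst.
rewrite (_ : (fun x => _) = fun=> (0 : R)); first exact: IH.
by apply/funext => x; exact: derive_cst.
Qed.

Lemma is_CkD (R : realType) (V : normedModType R) (k : nat) (f g : V -> R) :
  is_Ck k f -> is_Ck k g -> is_Ck k (fun x => f x + g x).
Proof.
elim: k f g => [|k IH] f g.
  by move=> cf cg x; apply: cvgD; [exact: cf|exact: cg].
move=> [df Df] [dg Dg].
split=> [x|v]; first exact (differentiableD (df x) (dg x)).
rewrite (_ : (fun x => _) = (fun x => 'D_v f x + 'D_v g x : R)).
  exact (IH _ _ (Df v) (Dg v)).
apply/funext => x; apply: (@deriveD _ _ _ f g); exact: diff_derivable.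
Qed.

Lemma is_CkM (R : realType) (V : normedModType R) (k : nat) (f g : V -> R) :
  is_Ck k f -> is_Ck k g -> is_Ck k (fun x => f x * g x).
Proof.
elim: k f g => [|k IH] f g.
  by move=> cf cg x; apply: cvgM; [exact: cf|exact: cg].
move=> Cf Cg; have [df Df] := Cf; have [dg Dg] := Cg.
split=> [x|v]; first exact (differentiableM (df x) (dg x)).
rewrite (_ : (fun x => _) = (fun x => f x * 'D_v g x + g x * 'D_v f x : R)).
  apply: is_CkD; apply: IH; [exact: is_CkS|exact: Dg|exact: is_CkS|exact: Df].
apply/funext => x; apply: (@deriveM _ _ f g); exact: diff_derivable.
Qed.

Lemma is_Ck_sum (R : realType) (V : normedModType R) (k n : nat)
    (f : 'I_n -> V -> R) :
  (forall i, is_Ck k (f i)) -> is_Ck k (fun x => \sum_(i < n) f i x).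
Proof.
elim: n f => [|n IH] f Cf.
  rewrite (_ : (fun x => _) = fun=> 0); first exact: is_Ck_cst.
  by apply/funext => p; rewrite big_ord0.
rewrite (_ : (fun x => _) = fun x => f ord0 x + \sum_(i < n) f (lift ord0 i) x).
  by apply: is_CkD => //; exact: IH.
by apply/funext => p; rewrite big_ord_recl.
Qed.

Lemma derive_coord (R : realType) (m n : nat) (i : 'I_m) (j : 'I_n)
    (x v : 'M[R]_(m, n)) : 'D_v (fun y : 'M[R]_(m, n) => y i j) x = v i j.
Proof.
have lin : linear (fun y : 'M[R]_(m, n) => y i j : R).
  by move=> a u w; rewrite !mxE.
pose fM := GRing.isLinear.Build _ _ _ _ _ lin.
pose f : {linear _ -> _} := HB.pack (fun y : 'M[R]_(m, n) => y i j : R) fM.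
rewrite deriveE; last exact: differentiable_coord.
by rewrite (@diff_lin _ _ _ f x)//; exact: coord_continuous.
Qed.

Lemma is_Ck_coord (R : realType) (k : nat) (i : 'I_5) :
  is_Ck k (fun x : nilG R => x i 0).
Proof.
have dc x : differentiable (fun x : nilG R => x i 0 : R) x.
  exact: (@differentiable_coord R 5 1).
case: k => [|k]; first by move=> x; exact: differentiable_continuous.
split=> // v; rewrite (_ : (fun x => _) = fun=> v i 0); first exact: is_Ck_cst.
apply/funext => x; exact: derive_coord.
Qed.

(** * Smooth functions and vector fields on the quotient *)

Lemma smooth_cst (R : realType) (Gam : groupClosed (nilG R)) (a : R) :
  smooth (fun _ : nilM Gam => a).
Proof. by move=> k; exact: is_Ck_cst. Qed.

Lemma smoothD (R : realType) (Gam : groupClosed (nilG R))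
    (f g : nilM Gam -> R) :
  smooth f -> smooth g -> smooth (fun p => f p + g p).
Proof. by move=> Cf Cg k; apply: is_CkD; [exact: Cf|exact: Cg]. Qed.

Lemma smoothM (R : realType) (Gam : groupClosed (nilG R))
    (f g : nilM Gam -> R) :
  smooth f -> smooth g -> smooth (fun p => f p * g p).
Proof. by move=> Cf Cg k; apply: is_CkM; [exact: Cf|exact: Cg]. Qed.

Lemma smoothN (R : realType) (Gam : groupClosed (nilG R)) (f : nilM Gam -> R) :
  smooth f -> smooth (fun p => - f p).
Proof.
move=> Cf; rewrite (_ : (fun p => _) = fun p => -1 * f p).
  exact/smoothM/Cf/smooth_cst.
by apply/funext => p; rewrite mulN1r.
Qed.

Lemma smoothB (R : realType) (Gam : groupClosed (nilG R))
    (f g : nilM Gam -> R) :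
  smooth f -> smooth g -> smooth (fun p => f p - g p).
Proof. by move=> Cf Cg; exact/smoothD/smoothN. Qed.

Lemma smooth_sum (R : realType) (Gam : groupClosed (nilG R)) (n : nat)
    (f : 'I_n -> nilM Gam -> R) :
  (forall i, smooth (f i)) -> smooth (fun p => \sum_(i < n) f i p).
Proof. by move=> Cf k; apply: is_Ck_sum => i; exact: Cf. Qed.

(** The value at x of the left-invariant field with value v at 0, in the global
    linear coordinates of the group: the part of the Baker-Campbell-Hausdorff
    product of x and v that is linear in v. *)
Definition left_invariant_at (R : realType) (x v : nilG R) : nilG R :=
  v + 2^-1 *: lie_br x v + 12^-1 *: lie_br x (lie_br x v).

(** The derivative along a field at the coset of x may be computed with x in
    place of the chosen representative. *)
Lemma pi_repr_mul (R : realType) (Gam : groupClosed (nilG R)) (x y : nilG R) :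
  \pi_(nilM Gam) (repr (\pi_(nilM Gam) x) * y)%g = \pi_(nilM Gam) (x * y)%g.
Proof.
apply/(@eqmodP _ (same_coset_equiv Gam)) => /=.
rewrite /same_coset invgM mulgA mulgK.
by apply/(@eqmodP _ (same_coset_equiv Gam)); exact: reprK.
Qed.

Lemma left_invariant_atE (R : realType) (x v : nilG R) (k : nat) :
  left_invariant_at x v (ix k) 0 = v (ix k) 0 + 2^-1 * lie_br x v (ix k) 0
    + 12^-1 * lie_br x (lie_br x v) (ix k) 0.
Proof.
rewrite /left_invariant_at; move: (lie_br x v) => a; move: (lie_br x a) => b.
by rewrite !mxE.
Qed.

Lemma nilG_mulE (R : realType) (x v : nilG R) (h : R) :
  (x * (h *: v : nilG R))%g =
    x + h *: left_invariant_at x v + h ^+ 2 *: (12^-1 *: lie_br v (lie_br v x)).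
Proof.
have [a1 a2 a3 a4 a5] := bchE x (h *: v).
have [b1 b2 b3 b4 b5] := lie_brE x v.
have [c1 c2 c3 c4 c5] := lie_brE x (lie_br x v).
have [d1 d2 d3 d4 d5] := lie_brE v x.
have [e1 e2 e3 e4 e5] := lie_brE v (lie_br v x).
have rE k : (x + h *: left_invariant_at x v
    + h ^+ 2 *: (12^-1 *: lie_br v (lie_br v x))) (ix k) 0 =
    x (ix k) 0 + h * left_invariant_at x v (ix k) 0
    + h ^+ 2 * (12^-1 * lie_br v (lie_br v x) (ix k) 0).
  move: (left_invariant_at x v) (lie_br v (lie_br v x)) => w z; by rewrite !mxE.
have hE k : (h *: v) (ix k) 0 = h * v (ix k) 0 by rewrite mxE.
apply: (@col5P R (bch x (h *: v))).
rewrite a1 a2 a3 a4 a5 !hE !rE !left_invariant_atE.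
by split; rewrite ?(c1, c2, c3, c4, c5, e1, e2, e3, e4, e5)
  ?(b1, b2, b3, b4, b5, d1, d2, d3, d4, d5); ring.
Qed.

Lemma diff_curve (R : realType) (V : normedModType R) (x w z : V) :
  differentiable (fun h : R => x + h *: w + h ^+ 2 *: z : V) (0 : R) /\
  'd (fun h : R => x + h *: w + h ^+ 2 *: z : V) (0 : R) (1 : R) = w.
Proof.
have dsq : differentiable (fun h : R => h ^+ 2 : R) (0 : R).
  by apply/derivable1_diffP; exact: exprn_derivable.
have dsq0 : 'd (fun h : R => h ^+ 2 : R) (0 : R) (1 : R) = 0.
  by rewrite -deriveE// exp_derive expr1 scaler0 scale0r.
have did : differentiable (fun h : R => h) (0 : R).
  by apply/derivable1_diffP; exact: derivable_id.
have d1 : differentiable (fun h : R => h *: w : V) (0 : R).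
  exact: (@differentiableZl _ _ _ id).
have d2 : differentiable (fun h : R => h ^+ 2 *: z : V) (0 : R).
  exact: (@differentiableZl _ _ _ (fun h : R => h ^+ 2 : R)).
have d0 : differentiable (fun _ : R => x : V) (0 : R).
  exact: differentiable_cst.
have e1 : 'd (fun h : R => h *: w : V) (0 : R) (1 : R) = w.
  rewrite (@diffZl _ _ _ (fun h : R => h) w (0 : R) did).
  by rewrite -deriveE// derive_id scale1r.
have e2 : 'd (fun h : R => h ^+ 2 *: z : V) (0 : R) (1 : R) = 0.
  rewrite (@diffZl _ _ _ (fun h : R => h ^+ 2 : R) z (0 : R) dsq).
  by rewrite dsq0 scale0r.
have e0 : 'd (fun _ : R => x : V) (0 : R) (1 : R) = 0.
  by rewrite diff_cst.
have d01 := differentiableD d0 d1.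
split; first exact (differentiableD d01 d2).
transitivity (('d (fun _ : R => x : V) (0 : R) (1 : R)
  + 'd (fun h : R => h *: w : V) (0 : R) (1 : R))
  + 'd (fun h : R => h ^+ 2 *: z : V) (0 : R) (1 : R)).
  have := diffD d01 d2; rewrite (diffD d0 d1).
  by move=> /(congr1 (fun f : R -> V => f (1 : R))).
by rewrite e0 e1 e2 addr0 add0r.
Qed.

Lemma nilG_mulg0 (R : realType) (x : nilG R) : (x * (0 : nilG R))%g = x.
Proof. exact: bchx0. Qed.

(** Upstairs on the group, a vector field with components X acts as the
    derivation along sum_j X^j e_j. *)
Lemma vderivE (R : realType) (Gam : groupClosed (nilG R))
    (X : nilM Gam -> 'cV[R]_5) (f : nilM Gam -> R) (x : nilG R) :
  smooth f ->
  vderiv X f (\pi_(nilM Gam) x) =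
  'D_(left_invariant_at x (X (\pi_(nilM Gam) x)))
    (fun y : nilG R => f (\pi_(nilM Gam) y)) x.
Proof.
move=> /(_ 1%N)[df _]; rewrite /vderiv; set v := X _.
set F := fun y : nilG R => f (\pi_(nilM Gam) y).
rewrite (_ : (fun y => _) = fun y : nilG R => F (x * y)%g); last first.
  by apply/funext => y; rewrite /F pi_repr_mul.
have [dg gE] := diff_curve x (left_invariant_at x v)
  (12^-1 *: lie_br v (lie_br v x)).
set g := (fun h : R => _) in dg gE.
have g0 : g 0 = x by rewrite /g scale0r expr0n scale0r !addr0.
have dFg : differentiable F (g 0) by rewrite g0; exact: df.
transitivity ('D_(1 : R) (F \o g) (0 : R)).
  (* both sides are limits of the same difference quotient: g is the curve
     s |-> x * (s v), up to its expression as a polynomial in s *)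
  rewrite /derive; apply: (congr1 (fun u : R -> R => lim (u @ (0 : R)^'))).
  apply/funext => h /=.
  rewrite !addr0 nilG_mulE -/(g h) nilG_mulg0 -{1}g0.
  by rewrite [h%:A]mulr1.
rewrite deriveE; last exact: differentiable_comp.
rewrite deriveE; last exact: df.
by rewrite diff_comp //= gE g0.
Qed.

Lemma lie_br_coord (R : realType) (x y : 'cV[R]_5) (i : 'I_5) :
  lie_br x y i 0 =
    (x (ix 1) 0 * y (ix 2) 0 + -1 * (x (ix 2) 0 * y (ix 1) 0)) * ebasis R 3 i 0
    + ((x (ix 2) 0 * y (ix 4) 0 + -1 * (x (ix 4) 0 * y (ix 2) 0))
       + -1 * (x (ix 1) 0 * y (ix 3) 0 + -1 * (x (ix 3) 0 * y (ix 1) 0)))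
      * ebasis R 5 i 0.
Proof.
rewrite /lie_br; move: (ebasis R 3) (ebasis R 5) => a b.
by rewrite !mxE !mulN1r.
Qed.

Lemma is_Ck_lie_br (R : realType) (k : nat) (u v : nilG R -> 'cV[R]_5) :
  (forall i, is_Ck k (fun x => u x i 0)) ->
  (forall i, is_Ck k (fun x => v x i 0)) ->
  forall i, is_Ck k (fun x => lie_br (u x) (v x) i 0).
Proof.
move=> Cu Cv i.
under [fun x => _]funext do rewrite lie_br_coord.
by do !(apply: is_CkD || apply: is_CkM || exact: is_Ck_cst || exact: Cu
  || exact: Cv).
Qed.

Lemma is_Ck_left_invariant_at (R : realType) (k : nat)
    (v : nilG R -> 'cV[R]_5) :
  (forall i, is_Ck k (fun x => v x i 0)) ->
  forall i, is_Ck k (fun x => left_invariant_at x (v x) i 0).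
Proof.
move=> Cv i; rewrite (_ : i = ix i.+1); last by rewrite /ix /= inord_val.
under [fun x => _]funext do rewrite left_invariant_atE.
have Cb := is_Ck_lie_br (@is_Ck_coord R k) Cv.
apply: is_CkD; first apply: is_CkD; first exact: Cv.
  by apply: is_CkM; [exact: is_Ck_cst|exact: Cb].
apply: is_CkM; first exact: is_Ck_cst.
exact: (is_Ck_lie_br (@is_Ck_coord R k) Cb).
Qed.

Lemma derive_sum_coord (R : realType) (n : nat) (F : 'cV[R]_n -> R)
    (x v : 'cV[R]_n) :
  differentiable F x -> 'D_v F x = \sum_(i < n) v i 0 * 'D_(delta_mx i 0) F x.
Proof.
move=> dF; rewrite deriveE//.
have {1}-> : v = \sum_(i < n) v i 0 *: delta_mx i 0.
  rewrite {1}(matrix_sum_delta v); apply: eq_bigr => i _.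
  by rewrite big_ord1.
rewrite linear_sum; apply: eq_bigr => i _.
by rewrite linearZ deriveE.
Qed.

(** The coefficients of left_invariant_at are polynomial in the point, hence the
    derivative of a smooth function along a smooth field is smooth. *)
Lemma smooth_vderiv (R : realType) (Gam : groupClosed (nilG R))
    (X : nilM Gam -> 'cV[R]_5) (f : nilM Gam -> R) :
  smooth_mx X -> smooth f -> smooth (vderiv X f).
Proof.
move=> CX Cf k.
under [fun x => _]funext do rewrite vderivE//.
have dF x := (Cf 1%N).1 x.
under [fun x => _]funext do rewrite derive_sum_coord//.
apply: is_Ck_sum => i; apply: is_CkM; last exact: (Cf k.+1).2.
by apply: is_Ck_left_invariant_at => j; exact: CX.
Qed.

Lemma vderiv_cst (R : realType) (Gam : groupClosed (nilG R))
    (X : nilM Gam -> 'cV[R]_5) (a : R) (p : nilM Gam) :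
  vderiv X (fun=> a) p = 0.
Proof. exact: derive_cst. Qed.

Lemma vderivD (R : realType) (Gam : groupClosed (nilG R))
    (X : nilM Gam -> 'cV[R]_5) (f g : nilM Gam -> R) (p : nilM Gam) :
  smooth f -> smooth g ->
  vderiv X (fun q => f q + g q) p = vderiv X f p + vderiv X g p.
Proof.
move=> Cf Cg; rewrite -(reprK p) !vderivE//; last exact: smoothD.
apply: deriveD; apply: diff_derivable; [exact: (Cf 1%N).1|exact: (Cg 1%N).1].
Qed.

Lemma vderivM (R : realType) (Gam : groupClosed (nilG R))
    (X : nilM Gam -> 'cV[R]_5) (f g : nilM Gam -> R) (p : nilM Gam) :
  smooth f -> smooth g ->
  vderiv X (fun q => f q * g q) p = f p * vderiv X g p + g p * vderiv X f p.
Proof.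
move=> Cf Cg; rewrite -(reprK p) !vderivE//; last exact: smoothM.
apply: deriveM; apply: diff_derivable; [exact: (Cf 1%N).1|exact: (Cg 1%N).1].
Qed.

Lemma vderivZ (R : realType) (Gam : groupClosed (nilG R))
    (X : nilM Gam -> 'cV[R]_5) (a : R) (f : nilM Gam -> R) (p : nilM Gam) :
  smooth f -> vderiv X (fun q => a * f q) p = a * vderiv X f p.
Proof.
by move=> Cf; rewrite vderivM ?vderiv_cst ?mulr0 ?addr0//; exact: smooth_cst.
Qed.

Lemma vderivB (R : realType) (Gam : groupClosed (nilG R))
    (X : nilM Gam -> 'cV[R]_5) (f g : nilM Gam -> R) (p : nilM Gam) :
  smooth f -> smooth g ->
  vderiv X (fun q => f q - g q) p = vderiv X f p - vderiv X g p.
Proof.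
move=> Cf Cg; under [fun q => _]funext do rewrite -[- _]mulN1r.
rewrite vderivD ?vderivZ ?mulN1r//.
by apply: smoothM => //; exact: smooth_cst.
Qed.

Lemma vderiv_sum (R : realType) (Gam : groupClosed (nilG R))
    (X : nilM Gam -> 'cV[R]_5) (n : nat) (f : 'I_n -> nilM Gam -> R)
    (p : nilM Gam) :
  (forall i, smooth (f i)) ->
  vderiv X (fun q => \sum_(i < n) f i q) p = \sum_(i < n) vderiv X (f i) p.
Proof.
elim: n f => [|n IH] f Cf.
  by under [fun q => _]funext do rewrite big_ord0; rewrite vderiv_cst big_ord0.
under [fun q => _]funext do rewrite big_ord_recl.
rewrite vderivD//; last exact: smooth_sum.
by rewrite IH// [RHS]big_ord_recl.
Qed.

(** * The Courant bracket in the left-invariant frame *)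

(** Derivative along X of each component of a column of functions. *)
Definition vderiv_col (R : realType) (Gam : groupClosed (nilG R)) (n : nat)
    (X : nilM Gam -> 'cV[R]_5) (u : nilM Gam -> 'cV[R]_n) :
    nilM Gam -> 'cV[R]_n :=
  fun p => \col_i vderiv X (fun q => u q i 0) p.

(** Courant bracket of the left-invariant sections with values u and v: the
    exact term vanishes, since the pairings involved are constant, and the Lie
    derivative of b along X is the coadjoint term - b [X, .]. *)
Definition courant_const (R : realType) (u v : 'cV[R]_(5 + 5)) :
    'cV[R]_(5 + 5) :=
  col_mx (lie_br (usubmx u) (usubmx v))
    (\col_j (contr (lie_br (usubmx v) (delta_mx j 0)) (dsubmx u)
             - contr (lie_br (usubmx u) (delta_mx j 0)) (dsubmx v))).

Lemma usubmxD_coord (R : realType) (u v : 'cV[R]_(5 + 5)) (k : 'I_5) :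
  usubmx (u + v) k 0 = usubmx u k 0 + usubmx v k 0.
Proof. by rewrite !mxE. Qed.

Lemma dsubmxD_coord (R : realType) (u v : 'cV[R]_(5 + 5)) (k : 'I_5) :
  dsubmx (u + v) k 0 = dsubmx u k 0 + dsubmx v k 0.
Proof. by rewrite !mxE. Qed.

Lemma usubmxN_coord (R : realType) (u : 'cV[R]_(5 + 5)) (k : 'I_5) :
  usubmx (- u) k 0 = - usubmx u k 0.
Proof. by rewrite !mxE. Qed.

Lemma dsubmxN_coord (R : realType) (u : 'cV[R]_(5 + 5)) (k : 'I_5) :
  dsubmx (- u) k 0 = - dsubmx u k 0.
Proof. by rewrite !mxE. Qed.

Lemma vderiv_usubmx (R : realType) (Gam : groupClosed (nilG R))
    (X : nilM Gam -> 'cV[R]_5) (u : nilM Gam -> 'cV[R]_(5 + 5)) (k : 'I_5)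
    (p : nilM Gam) :
  vderiv X (fun q => usubmx (u q) k 0) p = usubmx (vderiv_col X u p) k 0.
Proof. by under [fun q => _]funext do rewrite mxE; rewrite !mxE. Qed.

Lemma vderiv_dsubmx (R : realType) (Gam : groupClosed (nilG R))
    (X : nilM Gam -> 'cV[R]_5) (u : nilM Gam -> 'cV[R]_(5 + 5)) (k : 'I_5)
    (p : nilM Gam) :
  vderiv X (fun q => dsubmx (u q) k 0) p = dsubmx (vderiv_col X u p) k 0.
Proof. by under [fun q => _]funext do rewrite mxE; rewrite !mxE. Qed.

Lemma usubmx_vderiv (R : realType) (Gam : groupClosed (nilG R))
    (X : nilM Gam -> 'cV[R]_5) (u : nilM Gam -> 'cV[R]_(5 + 5))
    (p : nilM Gam) :
  usubmx (vderiv_col X u p) = vderiv_col X (fun q => usubmx (u q)) p.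
Proof. by apply/colP => k; rewrite -vderiv_usubmx [RHS]mxE. Qed.

Lemma dsubmx_vderiv (R : realType) (Gam : groupClosed (nilG R))
    (X : nilM Gam -> 'cV[R]_5) (u : nilM Gam -> 'cV[R]_(5 + 5))
    (p : nilM Gam) :
  dsubmx (vderiv_col X u p) = vderiv_col X (fun q => dsubmx (u q)) p.
Proof. by apply/colP => k; rewrite -vderiv_dsubmx [RHS]mxE. Qed.

Lemma smooth_usubmx (R : realType) (Gam : groupClosed (nilG R))
    (u : nilM Gam -> 'cV[R]_(5 + 5)) :
  smooth_mx u -> smooth_mx (fun p => usubmx (u p)).
Proof.
by move=> Cu i j; under [fun q => _]funext do rewrite mxE; exact: Cu.
Qed.

Lemma smooth_dsubmx (R : realType) (Gam : groupClosed (nilG R))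
    (u : nilM Gam -> 'cV[R]_(5 + 5)) :
  smooth_mx u -> smooth_mx (fun p => dsubmx (u p)).
Proof.
by move=> Cu i j; under [fun q => _]funext do rewrite mxE; exact: Cu.
Qed.

Lemma contrE (R : realType) (v a : 'cV[R]_5) :
  contr v a = v (ix 1) 0 * a (ix 1) 0 + v (ix 2) 0 * a (ix 2) 0
    + v (ix 3) 0 * a (ix 3) 0 + v (ix 4) 0 * a (ix 4) 0
    + v (ix 5) 0 * a (ix 5) 0.
Proof.
have oE (i : 'I_5) : i = ix i.+1 by rewrite /ix /= inord_val.
rewrite /contr (eq_bigr (fun k : 'I_5 => v (ix k.+1) 0 * a (ix k.+1) 0)).
  by rewrite !big_ord_recr big_ord0 /= add0r.
by move=> i _; rewrite -oE.
Qed.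

Lemma vderiv_contr (R : realType) (Gam : groupClosed (nilG R))
    (X v a : nilM Gam -> 'cV[R]_5) (p : nilM Gam) :
  smooth_mx v -> smooth_mx a ->
  vderiv X (fun q => contr (v q) (a q)) p
  = contr (vderiv_col X v p) (a p) + contr (v p) (vderiv_col X a p).
Proof.
move=> Cv Ca; rewrite vderiv_sum; last by move=> i; exact: smoothM.
rewrite /contr -big_split; apply: eq_bigr => i _.
by rewrite vderivM// !mxE addrC [X in X + _]mulrC.
Qed.

(** As e_j has constant components, only X is differentiated in [X, e_j]. *)
Lemma contr_frame_bracket (R : realType) (Gam : groupClosed (nilG R))
    (X : nilM Gam -> 'cV[R]_5) (a : 'cV[R]_5) (j : 'I_5) (p : nilM Gam) :
  contr (vbracket X (frame Gam j) p) a
  = contr (lie_br (X p) (delta_mx j 0)) a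
    - contr (vderiv_col (frame Gam j) X p) a.
Proof.
rewrite /contr -sumrB; apply: eq_bigr => k _; rewrite -mulrBl; congr (_ * _).
rewrite /vbracket; set z := lie_br _ _.
rewrite mxE [X in X + _]mxE.
rewrite -[vderiv X _ p]/(vderiv X (fun=> delta_mx j 0 k 0) p) vderiv_cst.
by rewrite sub0r addrC; congr (_ - _); rewrite mxE.
Qed.

(** The Courant bracket is the bracket of the constant extensions of u p and
    v p, corrected by first derivatives.  Those of the Lie derivatives of the
    1-forms and of the exact term add up to D_X b, - D_Y a and
    <D_j u, v> - <u, D_j v>. *)
Lemma courantE (R : realType) (Gam : groupClosed (nilG R))
    (u v : nilM Gam -> 'cV[R]_(5 + 5)) (p : nilM Gam) :
  smooth_mx u -> smooth_mx v ->
  courant u v p =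
    vderiv_col (fun q => usubmx (u q)) v p
    - vderiv_col (fun q => usubmx (v q)) u p
    + col_mx 0 (\col_j (pairing (vderiv_col (frame Gam j) u p) (v p)
                        - pairing (u p) (vderiv_col (frame Gam j) v p)))
    + courant_const (u p) (v p).
Proof.
move=> Cu Cv.
rewrite /courant /courant_const.
set A := vderiv_col _ v p; set B := vderiv_col _ u p.
set C := \col_j (pairing _ _ - _); set D := \col_j _.
rewrite -[RHS]vsubmxK !linearD !linearN /= !col_mxKu !col_mxKd addr0.
congr col_mx.
  apply/colP => k; rewrite /vbracket.
  set z := lie_br _ _.
  have uE (a b c : 'cV[R]_5) : (a - b + c) k 0 = a k 0 - b k 0 + c k 0.
    by rewrite !mxE.
  by rewrite uE mxE [X in X + _]mxE !vderiv_usubmx.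
apply/colP => j.
have CX := smooth_usubmx Cu; have Ca := smooth_dsubmx Cu.
have CY := smooth_usubmx Cv; have Cb := smooth_dsubmx Cv.
set h := ext_d _ p.
have hE : h j 0 =
    contr (vderiv_col (frame Gam j) (fun q => usubmx (u q)) p) (dsubmx (v p))
    + contr (usubmx (u p)) (vderiv_col (frame Gam j) (fun q => dsubmx (v q)) p)
    - (contr (vderiv_col (frame Gam j) (fun q => usubmx (v q)) p) (dsubmx (u p))
    + contr (usubmx (v p))
        (vderiv_col (frame Gam j) (fun q => dsubmx (u q)) p)).
  rewrite mxE vderivB; first by rewrite !vderiv_contr.
    by apply: smooth_sum => i; exact: smoothM.
  by apply: smooth_sum => i; exact: smoothM.
have lE (a b e : 'cV[R]_5) (c : R) :
    (a - b - c *: e) j 0 = a j 0 - b j 0 - c * e j 0 by rewrite !mxE.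
have rE (a b e f : 'cV[R]_5) :
    (a - b + e + f) j 0 = a j 0 - b j 0 + e j 0 + f j 0 by rewrite !mxE.
have dE (X c : nilM Gam -> 'cV[R]_5) : lie_deriv X c p j 0
    = vderiv X (fun q => c q j 0) p - contr (vbracket X (frame Gam j) p) (c p).
  by rewrite mxE.
rewrite lE rE hE !dE !contr_frame_bracket !vderiv_dsubmx -/A -/B.
have CE : C j 0 = pairing (vderiv_col (frame Gam j) u p) (v p)
    - pairing (u p) (vderiv_col (frame Gam j) v p) by rewrite mxE.
have DE : D j 0 = contr (lie_br (usubmx (v p)) (delta_mx j 0)) (dsubmx (u p))
    - contr (lie_br (usubmx (u p)) (delta_mx j 0)) (dsubmx (v p)).
  by rewrite mxE.
rewrite CE DE /pairing.
move: (usubmx_vderiv (frame Gam j) u p) (dsubmx_vderiv (frame Gam j) u p).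
move: (usubmx_vderiv (frame Gam j) v p) (dsubmx_vderiv (frame Gam j) v p).
move: (vderiv_col _ u p) (vderiv_col _ v p) => du dv.
move=> -> -> -> ->.
move: (dsubmx A j 0) (dsubmx B j 0) => dA dB.
do !(move: (contr _ _); intro).
by field.
Qed.

Lemma smooth_mxD (R : realType) (Gam : groupClosed (nilG R)) (m n : nat)
    (A B : nilM Gam -> 'M[R]_(m, n)) :
  smooth_mx A -> smooth_mx B -> smooth_mx (fun p => A p + B p).
Proof.
move=> CA CB i j; under [fun p => _]funext do rewrite mxE.
exact (smoothD (CA i j) (CB i j)).
Qed.

Lemma smooth_mxB (R : realType) (Gam : groupClosed (nilG R)) (m n : nat)
    (A B : nilM Gam -> 'M[R]_(m, n)) :
  smooth_mx A -> smooth_mx B -> smooth_mx (fun p => A p - B p).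
Proof.
move=> CA CB i j; under [fun p => _]funext do rewrite mxE [X in _ + X]mxE.
exact (smoothB (CA i j) (CB i j)).
Qed.

Lemma smooth_mx_cst (R : realType) (Gam : groupClosed (nilG R)) (m n : nat)
    (A : 'M[R]_(m, n)) :
  smooth_mx (fun _ : nilM Gam => A).
Proof. by move=> i j; exact: smooth_cst. Qed.

Lemma smooth_col_mx (R : realType) (Gam : groupClosed (nilG R))
    (m n : nat) (a : nilM Gam -> 'cV[R]_m) (b : nilM Gam -> 'cV[R]_n) :
  smooth_mx a -> smooth_mx b -> smooth_mx (fun p => col_mx (a p) (b p)).
Proof.
move=> Ca Cb i j; case: (split_ordP i) => k ->.
  by under [fun p => _]funext do rewrite col_mxEu; exact: Ca.
by under [fun p => _]funext do rewrite col_mxEd; exact: Cb.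
Qed.

Lemma smooth_contr (R : realType) (Gam : groupClosed (nilG R))
    (v a : nilM Gam -> 'cV[R]_5) :
  smooth_mx v -> smooth_mx a -> smooth (fun p => contr (v p) (a p)).
Proof. by move=> Cv Ca; apply: smooth_sum => i; exact: smoothM. Qed.

Lemma smooth_lie_br (R : realType) (Gam : groupClosed (nilG R))
    (u v : nilM Gam -> 'cV[R]_5) :
  smooth_mx u -> smooth_mx v -> smooth_mx (fun p => lie_br (u p) (v p)).
Proof.
move=> Cu Cv i j k; rewrite ord1; apply: is_Ck_lie_br => l.
  exact: Cu.
exact: Cv.
Qed.

Lemma smooth_vderiv_col (R : realType) (Gam : groupClosed (nilG R)) (n : nat)
    (X : nilM Gam -> 'cV[R]_5) (u : nilM Gam -> 'cV[R]_n) :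
  smooth_mx X -> smooth_mx u -> smooth_mx (vderiv_col X u).
Proof.
move=> CX Cu i j; rewrite /vderiv_col; under [fun p => _]funext do rewrite mxE.
exact (smooth_vderiv CX (Cu i 0)).
Qed.

Lemma smooth_pairing (R : realType) (Gam : groupClosed (nilG R))
    (u v : nilM Gam -> 'cV[R]_(5 + 5)) :
  smooth_mx u -> smooth_mx v -> smooth (fun p => pairing (u p) (v p)).
Proof.
move=> Cu Cv.
exact (smoothM (smooth_cst Gam 2^-1) (smoothD
  (smooth_contr (smooth_usubmx Cu) (smooth_dsubmx Cv))
  (smooth_contr (smooth_usubmx Cv) (smooth_dsubmx Cu)))).
Qed.

Lemma smooth_courant (R : realType) (Gam : groupClosed (nilG R))
    (u v : nilM Gam -> 'cV[R]_(5 + 5)) :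
  smooth_mx u -> smooth_mx v -> smooth_mx (courant u v).
Proof.
move=> Cu Cv; rewrite (funext (fun p => courantE p Cu Cv)).
have CX := smooth_usubmx Cu; have Ca := smooth_dsubmx Cu.
have CY := smooth_usubmx Cv; have Cb := smooth_dsubmx Cv.
have Ce j : smooth_mx (frame Gam j) by exact: smooth_mx_cst.
apply: smooth_mxD; first apply: smooth_mxD; first apply: smooth_mxB.
- exact: smooth_vderiv_col.
- exact: smooth_vderiv_col.
- apply: smooth_col_mx; first exact: smooth_mx_cst.
  move=> j k; under [fun p => _]funext do rewrite mxE.
  exact (smoothB (smooth_pairing (smooth_vderiv_col (Ce j) Cu) Cv)
    (smooth_pairing Cu (smooth_vderiv_col (Ce j) Cv))).
- apply: smooth_col_mx; first exact: smooth_lie_br.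
  move=> j k; under [fun p => _]funext do rewrite mxE.
  exact (smoothB (smooth_contr (smooth_lie_br CY (Ce j)) Ca)
    (smooth_contr (smooth_lie_br CX (Ce j)) Cb)).
Qed.

(** * The family of generalized almost contact pairs *)

(** The matrix of e_1 /\ e_3 - e_2 /\ e_4, and of e^1 /\ e^3 - e^2 /\ e^4. *)
Definition kodaira_form (R : realType) : 'M[R]_5 := wedge R 1 3 - wedge R 2 4.

(** The complex structure of the Kodaira surface. *)
Definition kodaira_cplx (R : realType) : 'M[R]_5 :=
  tens R 2 1 - tens R 1 2 + tens R 4 3 - tens R 3 4.

(** The endomorphism is that of J_0, conjugated by a beta-transform and then by
    a B-transform; up to sign, these are given by
    (t / 2) (e_1 /\ e_4 + e_2 /\ e_3) and t (e^1 /\ e^4 + e^2 /\ e^3). *)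
Definition kodaira_pair (R : realType) (Gam : groupClosed (nilG R)) (t : R) :
    gac_data Gam :=
  gac_of Gam (ebasis R 5) (ebasis R 5) (t *: kodaira_form R)
    ((2 * t - t ^+ 3) *: kodaira_form R) ((1 - t ^+ 2) *: kodaira_cplx R).
Arguments kodaira_pair {R} Gam t.

Lemma delta_mx_mul (R : realType) (m n : nat) (i : 'I_m) (j : 'I_n)
    (x : 'cV[R]_n) : delta_mx i j *m x = x j 0 *: delta_mx i 0.
Proof.
apply/colP => k; rewrite !mxE (bigD1 j)//= big1 => [|l ljN].
  by rewrite !mxE !eqxx !andbT addr0 mulrC.
by rewrite !mxE (negbTE ljN) andbF mul0r.
Qed.

Lemma kodaira_form_mulE (R : realType) (x : 'cV[R]_5)
    (z := kodaira_form R *m x) :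
  [/\ z (ix 1) 0 = x (ix 3) 0, z (ix 2) 0 = - x (ix 4) 0,
      z (ix 3) 0 = - x (ix 1) 0, z (ix 4) 0 = x (ix 2) 0
    & z (ix 5) 0 = 0].
Proof.
rewrite {}/z /kodaira_form /wedge !mulmxBl !delta_mx_mul.
by split; rewrite !mxE !ixE //= 
  !(mulr0, mulr1, addr0, add0r, subr0, oppr0, sub0r, opprK).
Qed.

Lemma kodaira_cplx_mulE (R : realType) (x : 'cV[R]_5)
    (z := kodaira_cplx R *m x) :
  [/\ z (ix 1) 0 = - x (ix 2) 0, z (ix 2) 0 = x (ix 1) 0,
      z (ix 3) 0 = - x (ix 4) 0, z (ix 4) 0 = x (ix 3) 0
    & z (ix 5) 0 = 0].
Proof.
rewrite {}/z /kodaira_cplx /tens mulmxBl !(mulmxDl, mulNmx) !delta_mx_mul.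
by split; rewrite !mxE !ixE //= 
  !(mulr0, mulr1, addr0, add0r, subr0, oppr0, sub0r, opprK).
Qed.

Lemma tr_kodaira_form (R : realType) : (kodaira_form R)^T = - kodaira_form R.
Proof.
rewrite /kodaira_form /wedge !linearB /= !trmx_delta.
by apply/matrixP => i j; rewrite !mxE; ring.
Qed.

Lemma tr_kodaira_cplx (R : realType) : (kodaira_cplx R)^T = - kodaira_cplx R.
Proof.
rewrite /kodaira_cplx /tens !(linearD, linearN) /= !trmx_delta.
by rewrite !opprK; apply/matrixP => i j; rewrite !mxE; ring.
Qed.

Lemma kodaira_Phi_mulE (R : realType) (Gam : groupClosed (nilG R)) (t : R)
    (p : nilM Gam) (u : 'cV[R]_(5 + 5)) (m := 1 - t ^+ 2) (n := 2 * t - t ^+ 3)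
    (x := fun k => usubmx u (ix k) 0) (a := fun k => dsubmx u (ix k) 0)
    (y := fun k => usubmx (gac_Phi (kodaira_pair Gam t) p *m u) (ix k) 0)
    (b := fun k => dsubmx (gac_Phi (kodaira_pair Gam t) p *m u) (ix k) 0) :
  [/\ y 1%N = - (m * x 2%N) - t * a 3%N, y 2%N = m * x 1%N + t * a 4%N,
      y 3%N = - (m * x 4%N) + t * a 1%N, y 4%N = m * x 3%N - t * a 2%N
    & y 5%N = 0] /\
  [/\ b 1%N = - (n * x 3%N) - m * a 2%N, b 2%N = n * x 4%N + m * a 1%N,
      b 3%N = n * x 1%N - m * a 4%N, b 4%N = - (n * x 2%N) + m * a 3%N
    & b 5%N = 0].
Proof.
have PhiE : gac_Phi (kodaira_pair Gam t) p =
    block_mx (m *: kodaira_cplx R) (- t *: kodaira_form R)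
             (- n *: kodaira_form R) (m *: kodaira_cplx R).
  rewrite /= !linearZ /= tr_kodaira_form tr_kodaira_cplx.
  by rewrite !scalerN opprK !scaleNr.
rewrite {}/y {}/b PhiE -(vsubmxK u) mul_block_col !col_mxKu !col_mxKd.
have [f1 f2 f3 f4 f5] := kodaira_form_mulE (usubmx u).
have [g1 g2 g3 g4 g5] := kodaira_form_mulE (dsubmx u).
have [h1 h2 h3 h4 h5] := kodaira_cplx_mulE (usubmx u).
have [k1 k2 k3 k4 k5] := kodaira_cplx_mulE (dsubmx u).
have E (c d : R) (A B : 'M[R]_5) (z w : 'cV[R]_5) k :
    (c *: A *m z + d *: B *m w) k 0 = c * (A *m z) k 0 + d * (B *m w) k 0.
  by rewrite -!scalemxAl; move: (A *m z) (B *m w) => ? ?; rewrite !mxE.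
by split; split; rewrite E ?(f1, f2, f3, f4, f5) ?(g1, g2, g3, g4, g5)
  ?(h1, h2, h3, h4, h5) ?(k1, k2, k3, k4, k5) /x /a; ring.
Qed.

Lemma ebasis5E (R : realType) :
  [/\ ebasis R 5 (ix 1) 0 = 0, ebasis R 5 (ix 2) 0 = 0, ebasis R 5 (ix 3) 0 = 0,
      ebasis R 5 (ix 4) 0 = 0 & ebasis R 5 (ix 5) 0 = 1].
Proof. by split; rewrite mxE ixE. Qed.

Lemma contr_ebasis5 (R : realType) (v : 'cV[R]_5) :
  contr v (ebasis R 5) = v (ix 5) 0 /\ contr (ebasis R 5) v = v (ix 5) 0.
Proof.
have [e1 e2 e3 e4 e5] := ebasis5E R.
by rewrite !contrE e1 e2 e3 e4 e5; split; ring.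
Qed.

Lemma kodaira_pair_gac (R : realType) (Gam : groupClosed (nilG R)) (t : R) :
  is_gac_pair (kodaira_pair Gam t).
Proof.
split; first by split; exact: smooth_mx_cst.
move=> p.
set Phi := gac_Phi _; set F := gac_F _ p; set eta := gac_eta _ p.
have FE : F = ebasis R 5 by [].
have eE : eta = ebasis R 5 by [].
have [e1 e2 e3 e4 e5] := ebasis5E R.
split.
- move=> u v.
  have [[u1 u2 u3 u4 u5] [v1 v2 v3 v4 v5]] := kodaira_Phi_mulE t p u.
  have [[w1 w2 w3 w4 w5] [z1 z2 z3 z4 z5]] := kodaira_Phi_mulE t p v.
  rewrite /pairing !contrE u1 u2 u3 u4 u5 v1 v2 v3 v4 v5.
  rewrite w1 w2 w3 w4 w5 z1 z2 z3 z4 z5; ring.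
- by rewrite FE eE (contr_ebasis5 _).1.
- have [[u1 u2 u3 u4 u5] [v1 v2 v3 v4 v5]] :=
    kodaira_Phi_mulE t p (col_mx F 0).
  rewrite -/Phi in u1 u2 u3 u4 u5 v1 v2 v3 v4 v5.
  rewrite -(vsubmxK (_ *m _)) -[RHS]vsubmxK !linear0.
  congr col_mx; apply: col5P.
    rewrite u1 u2 u3 u4 u5 col_mxKu col_mxKd FE e1 e2 e3 e4.
    by split; rewrite !mxE; ring.
  rewrite v1 v2 v3 v4 v5 col_mxKu col_mxKd FE e1 e2 e3 e4.
  by split; rewrite !mxE; ring.
- have [[u1 u2 u3 u4 u5] [v1 v2 v3 v4 v5]] :=
    kodaira_Phi_mulE t p (col_mx 0 eta).
  rewrite -/Phi in u1 u2 u3 u4 u5 v1 v2 v3 v4 v5.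
  rewrite -(vsubmxK (_ *m _)) -[RHS]vsubmxK !linear0.
  congr col_mx; apply: col5P.
    rewrite u1 u2 u3 u4 u5 col_mxKu col_mxKd eE e1 e2 e3 e4.
    by split; rewrite !mxE; ring.
  rewrite v1 v2 v3 v4 v5 col_mxKu col_mxKd eE e1 e2 e3 e4.
  by split; rewrite !mxE; ring.
- move=> u.
  have [[u1 u2 u3 u4 u5] [v1 v2 v3 v4 v5]] := kodaira_Phi_mulE t p u.
  rewrite -/Phi in u1 u2 u3 u4 u5 v1 v2 v3 v4 v5.
  have [[w1 w2 w3 w4 w5] [z1 z2 z3 z4 z5]] := kodaira_Phi_mulE t p (Phi p *m u).
  rewrite -/Phi in w1 w2 w3 w4 w5 z1 z2 z3 z4 z5.
  rewrite -[LHS]vsubmxK -(vsubmxK (- u)) add_col_mx !linearN /=.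
  rewrite FE eE (contr_ebasis5 _).1 (contr_ebasis5 _).2.
  have nE (a b : 'cV[R]_5) c k : (- a + c *: b) k 0 = - a k 0 + c * b k 0.
    by rewrite !mxE.
  congr col_mx; apply: col5P; rewrite !nE e1 e2 e3 e4 e5.
    rewrite w1 w2 w3 w4 w5 v1 v2 v3 v4 u1 u2 u3 u4.
    by split; ring.
  rewrite z1 z2 z3 z4 z5 v1 v2 v3 v4 u1 u2 u3 u4.
  by split; ring.
Qed.

(** * Closure of L under the Courant bracket *)

(** The equations of the bundle L of the pair with parameter t, in the
    components of w = (x + a) + i (y + b).  They say that a and b vanish on
    F = e_5 and that y + b equals - Phi (x + a) in the components other
    than e_5, which are not affected by the summand L_F. *)
Definition kodaira_L (R : realType) (t : R)
    (w : 'cV[R]_(5 + 5) * 'cV[R]_(5 + 5)) : Prop :=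
  let m := 1 - t ^+ 2 in let n := 2 * t - t ^+ 3 in
  let x k := usubmx w.1 (ix k) 0 in let a k := dsubmx w.1 (ix k) 0 in
  let y k := usubmx w.2 (ix k) 0 in let b k := dsubmx w.2 (ix k) 0 in
  [/\ y 1%N = m * x 2%N + t * a 3%N, y 2%N = - m * x 1%N + - t * a 4%N,
      y 3%N = m * x 4%N + - t * a 1%N, y 4%N = - m * x 3%N + t * a 2%N
    & a 5%N = 0] /\
  [/\ b 1%N = n * x 3%N + m * a 2%N, b 2%N = - n * x 4%N + - m * a 1%N,
      b 3%N = - n * x 1%N + m * a 4%N, b 4%N = n * x 2%N + - m * a 3%N
    & b 5%N = 0].

Lemma kodaira_LP (R : realType) (Gam : groupClosed (nilG R)) (t : R)
    (p : nilM Gam) (w : 'cV[R]_(5 + 5) * 'cV[R]_(5 + 5)) :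
  L_bundle (kodaira_pair Gam t) p w <-> kodaira_L t w.
Proof.
have [e1 e2 e3 e4 e5] := ebasis5E R.
have lEu (c : R) (e : 'cV[R]_(5 + 5)) k :
    usubmx (col_mx (c *: ebasis R 5) 0 + e) k 0
    = c * ebasis R 5 k 0 + usubmx e k 0.
  by rewrite usubmxD_coord col_mxKu mxE.
have lEd (c : R) (e : 'cV[R]_(5 + 5)) k :
    dsubmx (col_mx (c *: ebasis R 5) 0 + e) k 0 = dsubmx e k 0.
  by rewrite dsubmxD_coord col_mxKd mxE add0r.
split.
  case=> _ [_ [[a [b ->]] [e [e_eta e_F ->]] ->]].
  have [[u1 u2 u3 u4 u5] [v1 v2 v3 v4 v5]] := kodaira_Phi_mulE t p e.
  rewrite /kodaira_L /=.
  rewrite (contr_ebasis5 _).1 in e_eta; rewrite (contr_ebasis5 _).2 in e_F.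
  rewrite !lEu !lEd.
  rewrite !(usubmxN_coord, dsubmxN_coord).
  rewrite e1 e2 e3 e4 u1 u2 u3 u4 v1 v2 v3 v4 v5 e_F.
  by split; split; ring.
case=> [[u1 u2 u3 u4 u5] [v1 v2 v3 v4 v5]].
(* remove the component of w along F; what is left lies in E^(1,0) *)
pose e : 'cV[R]_(5 + 5) := w.1 - col_mx (usubmx w.1 (ix 5) 0 *: ebasis R 5) 0.
have eu k : usubmx e k 0 =
    usubmx w.1 k 0 - usubmx w.1 (ix 5) 0 * ebasis R 5 k 0.
  by rewrite /e linearB /= col_mxKu; move: (usubmx w.1) => z; rewrite !mxE.
have ed : dsubmx e = dsubmx w.1 by rewrite /e linearB /= col_mxKd subr0.
have [[x1 x2 x3 x4 x5] [z1 z2 z3 z4 z5]] := kodaira_Phi_mulE t p e.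
exists (col_mx (usubmx w.1 (ix 5) 0 *: ebasis R 5) 0,
        col_mx (usubmx w.2 (ix 5) 0 *: ebasis R 5) 0).
exists (e, - (gac_Phi (kodaira_pair Gam t) p *m e)); split.
- by exists (usubmx w.1 (ix 5) 0), (usubmx w.2 (ix 5) 0).
- exists e; split=> //.
    by rewrite (contr_ebasis5 _).1 eu e5 mulr1 subrr.
  by rewrite (contr_ebasis5 _).2 ed u5.
rewrite (surjective_pairing w) /=.
congr (_, _); first by rewrite /e addrC subrK.
have dE (c : R) (f : 'cV[R]_5) k :
  (c *: ebasis R 5 - f) k 0 = c * ebasis R 5 k 0 - f k 0 by rewrite !mxE.
have nE (f : 'cV[R]_5) k : (0 - f) k 0 = - f k 0 by rewrite !mxE add0r.
move: x1 x2 x3 x4 x5 z1 z2 z3 z4 z5; set f := _ *m e.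
move=> x1 x2 x3 x4 x5 z1 z2 z3 z4 z5.
rewrite -[LHS]vsubmxK -[f in RHS]vsubmxK opp_col_mx add_col_mx.
congr col_mx; apply: col5P.
  rewrite !dE e1 e2 e3 e4 e5 x1 x2 x3 x4 x5 !eu e1 e2 e3 e4 ed u1 u2 u3 u4.
  by split; ring.
rewrite !nE z1 z2 z3 z4 z5 !eu e1 e2 e3 e4 ed v1 v2 v3 v4 v5.
by split; ring.
Qed.

Lemma kodaira_L_sub (R : realType) (t : R)
    (w z : 'cV[R]_(5 + 5) * 'cV[R]_(5 + 5)) :
  kodaira_L t w -> kodaira_L t z -> kodaira_L t (w.1 - z.1, w.2 - z.2).
Proof.
move=> [[u1 u2 u3 u4 u5] [v1 v2 v3 v4 v5]] [[x1 x2 x3 x4 x5] [y1 y2 y3 y4 y5]].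
rewrite /kodaira_L /= !(usubmxD_coord, dsubmxD_coord).
rewrite !(usubmxN_coord, dsubmxN_coord).
rewrite u1 u2 u3 u4 u5 v1 v2 v3 v4 v5.
rewrite x1 x2 x3 x4 x5 y1 y2 y3 y4 y5.
by split; split; ring.
Qed.

(** L is stable under multiplication by i. *)
Lemma kodaira_L_mulI (R : realType) (t : R)
    (w : 'cV[R]_(5 + 5) * 'cV[R]_(5 + 5)) :
  kodaira_L t w -> kodaira_L t (- w.2, w.1).
Proof.
move=> [[u1 u2 u3 u4 u5] [v1 v2 v3 v4 v5]].
rewrite /kodaira_L /= !usubmxN_coord !dsubmxN_coord.
rewrite u1 u2 u3 u4 u5 v1 v2 v3 v4 v5.
by split; split; ring.
Qed.

Lemma kodaira_L_add (R : realType) (t : R)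
    (w z : 'cV[R]_(5 + 5) * 'cV[R]_(5 + 5)) :
  kodaira_L t w -> kodaira_L t z -> kodaira_L t (w.1 + z.1, w.2 + z.2).
Proof.
move=> Lw /kodaira_L_mulI /kodaira_L_mulI Lz.
by have := kodaira_L_sub Lw Lz; rewrite /= !opprK.
Qed.

(** The real and imaginary parts of <w, z> = 0 for w and z in L. *)
Lemma kodaira_L_isotropic (R : realType) (t : R)
    (w z : 'cV[R]_(5 + 5) * 'cV[R]_(5 + 5)) :
  kodaira_L t w -> kodaira_L t z ->
  pairing w.1 z.1 = pairing w.2 z.2 /\ pairing w.1 z.2 = - pairing w.2 z.1.
Proof.
move=> [[u1 u2 u3 u4 u5] [v1 v2 v3 v4 v5]] [[x1 x2 x3 x4 x5] [y1 y2 y3 y4 y5]].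
rewrite /pairing !contrE u1 u2 u3 u4 u5 v1 v2 v3 v4 v5.
rewrite x1 x2 x3 x4 x5 y1 y2 y3 y4 y5.
by split; ring.
Qed.

(** L is given by linear equations with constant coefficients, so the derivative
    of a section of L is a section of L. *)
Lemma kodaira_L_vderiv (R : realType) (Gam : groupClosed (nilG R)) (t : R)
    (X : nilM Gam -> 'cV[R]_5) (u v : nilM Gam -> 'cV[R]_(5 + 5))
    (p : nilM Gam) :
  smooth_mx u -> smooth_mx v -> (forall q, kodaira_L t (u q, v q)) ->
  kodaira_L t (vderiv_col X u p, vderiv_col X v p).
Proof.
move=> Cu Cv uvL.
have lin (f g h : nilM Gam -> R) (a b : R) : smooth g -> smooth h ->
    (forall q, f q = a * g q + b * h q) ->
    vderiv X f p = a * vderiv X g p + b * vderiv X h p.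
  move=> Cg Ch fE; rewrite (funext fE) vderivD ?vderivZ//;
    exact: (smoothM (smooth_cst Gam _)).
have zero (f : nilM Gam -> R) : (forall q, f q = 0) -> vderiv X f p = 0.
  by move=> fE; rewrite (funext fE) vderiv_cst.
have Cx k : smooth (fun q => usubmx (u q) k 0) by exact: smooth_usubmx.
have Ca k : smooth (fun q => dsubmx (u q) k 0) by exact: smooth_dsubmx.
rewrite /kodaira_L /= -!vderiv_usubmx -!vderiv_dsubmx.
split; split; (apply: lin => // q || apply: zero => q);
  by have [[? ? ? ? ?] [? ? ? ? ?]] := uvL q.
Qed.

Lemma courant_constE (R : realType) (u v : 'cV[R]_(5 + 5))
    (x := fun k => usubmx u (ix k) 0) (a := fun k => dsubmx u (ix k) 0)
    (y := fun k => usubmx v (ix k) 0) (b := fun k => dsubmx v (ix k) 0)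
    (c := fun k => usubmx (courant_const u v) (ix k) 0)
    (d := fun k => dsubmx (courant_const u v) (ix k) 0) :
  [/\ c 1%N = 0, c 2%N = 0, c 3%N = x 1%N * y 2%N - x 2%N * y 1%N, c 4%N = 0
    & c 5%N = (x 2%N * y 4%N - x 4%N * y 2%N)
      - (x 1%N * y 3%N - x 3%N * y 1%N)] /\
  [/\ d 1%N = - y 2%N * a 3%N + y 3%N * a 5%N + x 2%N * b 3%N - x 3%N * b 5%N,
      d 2%N = y 1%N * a 3%N - y 4%N * a 5%N - x 1%N * b 3%N + x 4%N * b 5%N,
      d 3%N = - y 1%N * a 5%N + x 1%N * b 5%N,
      d 4%N = y 2%N * a 5%N - x 2%N * b 5%N & d 5%N = 0].
Proof.
split; first by rewrite /c /courant_const col_mxKu; exact: lie_brE.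
have dE (k j : nat) : (k.-1 < 5)%N -> (j.-1 < 5)%N ->
    (delta_mx (ix j) 0 : 'cV[R]_5) (ix k) 0 = (k.-1 == j.-1)%:R.
  by move=> hk hj; rewrite mxE ixE// andbT.
have cE (j : 'I_5) (z e : 'cV[R]_5)
    (f := fun k => (delta_mx j 0 : 'cV[R]_5) (ix k) 0) :
    contr (lie_br z (delta_mx j 0)) e =
    (z (ix 1) 0 * f 2%N - z (ix 2) 0 * f 1%N) * e (ix 3) 0
    + ((z (ix 2) 0 * f 4%N - z (ix 4) 0 * f 2%N)
       - (z (ix 1) 0 * f 3%N - z (ix 3) 0 * f 1%N)) * e (ix 5) 0.
  have [g1 g2 g3 g4 g5] := lie_brE z (delta_mx j 0).
  by rewrite contrE g1 g2 g3 g4 g5 /f; ring.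
rewrite /d /courant_const col_mxKd.
by split; rewrite mxE !cE !dE //= /x /a /y /b; ring.
Qed.

(** The left-invariant sections of L are closed under the complex-linear
    extension of the Courant bracket. *)
Lemma kodaira_L_courant_const (R : realType) (t : R)
    (s w : 'cV[R]_(5 + 5) * 'cV[R]_(5 + 5)) :
  kodaira_L t s -> kodaira_L t w ->
  kodaira_L t (courant_const s.1 w.1 - courant_const s.2 w.2,
               courant_const s.1 w.2 + courant_const s.2 w.1).
Proof.
move=> [[u1 u2 u3 u4 u5] [v1 v2 v3 v4 v5]] [[x1 x2 x3 x4 x5] [y1 y2 y3 y4 y5]].
move: (courant_constE s.1 w.1) (courant_constE s.2 w.2).
move: (courant_constE s.1 w.2) (courant_constE s.2 w.1).
move: (courant_const s.1 w.1) (courant_const s.2 w.2).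
move: (courant_const s.1 w.2) (courant_const s.2 w.1) => E G A C; cbv zeta beta.
move=> [[e1 e2 e3 e4 _] [f1 f2 f3 f4 f5]] [[g1 g2 g3 g4 _] [h1 h2 h3 h4 h5]].
move=> [[a1 a2 a3 a4 _] [b1 b2 b3 b4 b5]] [[c1 c2 c3 c4 _] [d1 d2 d3 d4 d5]].
rewrite /kodaira_L /= !(usubmxD_coord, dsubmxD_coord).
rewrite !(usubmxN_coord, dsubmxN_coord).
rewrite a1 a2 a3 a4 b1 b2 b3 b4 b5 c1 c2 c3 c4 d1 d2 d3 d4 d5.
rewrite e1 e2 e3 e4 f1 f2 f3 f4 f5 g1 g2 g3 g4 h1 h2 h3 h4 h5.
rewrite u1 u2 u3 u4 u5 v3 v5 x1 x2 x3 x4 x5 y3 y5.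
by split; split; ring.
Qed.

Lemma kodaira_courant_closed (R : realType) (Gam : groupClosed (nilG R)) (t : R)
    (s w : nilM Gam -> 'cV[R]_(5 + 5) * 'cV[R]_(5 + 5)) :
  L_section (kodaira_pair Gam t) s -> L_section (kodaira_pair Gam t) w ->
  L_section (kodaira_pair Gam t) (courantC s w).
Proof.
move=> [Cs1 Cs2 sL] [Cw1 Cw2 wL].
have sLt q : kodaira_L t ((s q).1, (s q).2).
  by rewrite -surjective_pairing; apply/(kodaira_LP t q).
have wLt q : kodaira_L t ((w q).1, (w q).2).
  by rewrite -surjective_pairing; apply/(kodaira_LP t q).
split.
- exact (smooth_mxB (smooth_courant Cs1 Cw1) (smooth_courant Cs2 Cw2)).
- exact (smooth_mxD (smooth_courant Cs1 Cw2) (smooth_courant Cs2 Cw1)).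
move=> p; apply/kodaira_LP.
rewrite /courantC !courantE//.
have E j :
    pairing (vderiv_col (frame Gam j) (fun q => (s q).1) p) (w p).1
    - pairing (s p).1 (vderiv_col (frame Gam j) (fun q => (w q).1) p)
    = pairing (vderiv_col (frame Gam j) (fun q => (s q).2) p) (w p).2
    - pairing (s p).2 (vderiv_col (frame Gam j) (fun q => (w q).2) p) /\
    pairing (vderiv_col (frame Gam j) (fun q => (s q).1) p) (w p).2
    - pairing (s p).1 (vderiv_col (frame Gam j) (fun q => (w q).2) p)
    = - (pairing (vderiv_col (frame Gam j) (fun q => (s q).2) p) (w p).1
    - pairing (s p).2 (vderiv_col (frame Gam j) (fun q => (w q).1) p)).
  have [i1 i2] := kodaira_L_isotropic
    (kodaira_L_vderiv (frame Gam j) p Cs1 Cs2 sLt) (wLt p).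
  have [i3 i4] := kodaira_L_isotropic (sLt p)
    (kodaira_L_vderiv (frame Gam j) p Cw1 Cw2 wLt).
  by rewrite /= in i1 i2 i3 i4; rewrite i1 i2 i3 i4; split; ring.
have LA := kodaira_L_vderiv (fun q => usubmx (s q).1) p Cw1 Cw2 wLt.
have LB := kodaira_L_vderiv (fun q => usubmx (s q).2) p Cw1 Cw2 wLt.
have LC := kodaira_L_vderiv (fun q => usubmx (w q).1) p Cs1 Cs2 sLt.
have LD := kodaira_L_vderiv (fun q => usubmx (w q).2) p Cs1 Cs2 sLt.
have LK := kodaira_L_courant_const (sLt p) (wLt p).
(* D_X w for X = X_1 + i X_2 is D_(X_1) w + i D_(X_2) w *)
have LAB := kodaira_L_add LA (kodaira_L_mulI LB).
have LCD := kodaira_L_add LC (kodaira_L_mulI LD).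
have := kodaira_L_add (kodaira_L_sub LAB LCD) LK.
move: (courant_const (s p).1 _) (courant_const (s p).1 _) => k11 k12.
move: (courant_const (s p).2 _) (courant_const (s p).2 _) => k21 k22.
set P11 := col_mx 0 _; set P22 := col_mx 0 _.
set P12 := col_mx 0 _; set P21 := col_mx 0 _.
have -> : P11 = P22 by congr col_mx; apply/colP => j; rewrite !mxE (E j).1.
have -> : P12 = - P21.
  rewrite opp_col_mx oppr0; congr col_mx.
  by apply/colP => j; rewrite !mxE (E j).2.
rewrite /=; do !move: (vderiv_col _ _ _) => ?; move: P22 P21 => P Q.
by congr (kodaira_L t (_, _)); apply/colP => j; rewrite !mxE; ring.
Qed.

(** * Analytic dependence on the parameter *)

Lemma frame_deriv_cst (R : realType) (Gam : groupClosed (nilG R))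
    (I : seq 'I_5) (a : R) (p : nilM Gam) :
  `|frame_deriv I (fun=> a) p| <= `|a|.
Proof.
have [b -> ba] : exists2 b, frame_deriv I (fun _ : nilM Gam => a) = (fun=> b)
    & `|b| <= `|a|.
  elim: I => [|j I [b IH ba]]; first by exists a.
  exists 0; last by rewrite normr0.
  by apply/funext => q; rewrite /= -/(frame_deriv I _) IH vderiv_cst.
exact: ba.
Qed.

Lemma finite_ffun1 (n : nat) :
  finite_set [set al : {ffun 'I_1 -> nat} | (al ord0 < n)%N].
Proof.
apply: (@sub_finite_set _ _
  ((fun k : nat => [ffun _ => k] : {ffun 'I_1 -> nat}) @` `I_n)).
  move=> al /= aln; exists (al ord0) => //.
  by apply/ffunP => i; rewrite ffunE (ord1 i).
by apply: finite_image; exact: finite_II.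
Qed.

Lemma summable_finite_support (R : realType) (T : choiceType) (S : set T)
    (f : T -> R) :
  finite_set S -> (forall x, ~ S x -> f x = 0) ->
  summable [set: T] (fun x => (f x)%:E).
Proof.
move=> fS f0; rewrite /summable.
rewrite (_ : \esum_(x in _) _ = \esum_(x in S) `|(f x)%:E|)%E; last first.
  rewrite [RHS]esum_mkcond; apply: eq_esum => x _.
  case: ifPn => // /negP xS; rewrite f0 ?normr0 ?abse0//.
  by move=> Sx; apply: xS; rewrite inE.
rewrite esum_fset// fsbig_finite//=.
by rewrite sumEFin ltry.
Qed.

(** The power series at t0 is the Taylor expansion of q at t0, a finite sum with
    coefficients constant on M. *)
Lemma analytic_at_poly (R : realType) (Gam : groupClosed (nilG R))
    (q : {poly R}) (t0 : 'rV[R]_1) :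
  analytic_at (fun (t : 'rV[R]_1) (_ : nilM Gam) => q.[t 0 0]) t0.
Proof.
pose q0 := q \Po ('X + (t0 0 0)%:P).
exists (fun al _ => q0`_(al ord0)), 1; split=> // [al|s _].
  exact: smooth_cst.
split=> [I|p].
  exists (fun al => `|q0`_(al ord0)|); split=> [al p|].
    exact: frame_deriv_cst.
  apply: (summable_finite_support (finite_ffun1 (size q0))) => al /= /negP.
  by rewrite -leqNgt => h; rewrite nth_default// normr0 mul0r.
have sE N : \sum_(al : {ffun 'I_1 -> 'I_N})
    q0`_([ffun i => al i : nat] ord0) * monom [ffun i => al i : nat] s
    = \sum_(k < N) q0`_k * s 0 0 ^+ k.
  rewrite (reindex (fun k : 'I_N => [ffun _ => k] : {ffun 'I_1 -> 'I_N})) /=.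
    by apply: eq_bigr => k _; rewrite /monom big_ord1 !ffunE.
  exists (fun al => al ord0) => [k _|al _]; first by rewrite ffunE.
  by apply/ffunP => i; rewrite ffunE (ord1 i).
rewrite (funext sE).
have -> : q.[(t0 + s) 0 0] = q0.[s 0 0].
  by rewrite horner_comp !hornerE mxE addrC.
apply: cvg_near_cst; exists (size q0) => // N /= qN.
by rewrite -horner_coef_wide.
Qed.

Lemma connected_setT_rV1 (R : realType) : connected [set: 'rV[R]_1].
Proof.
have -> : [set: 'rV[R]_1] =
    (fun x : R => x *: const_mx 1 : 'rV[R]_1) @` [set: R].
  apply/seteqP; split=> // t _; exists (t 0 0) => //.
  by apply/rowP => i; rewrite !mxE mulr1 ord1.
apply: connected_continuous_connected; first by apply/connected_intervalP.
apply: continuous_subspaceT; exact: scalel_continuous.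
Qed.

Lemma analytic_at_cst (R : realType) (Gam : groupClosed (nilG R)) (a : R)
    (t0 : 'rV[R]_1) :
  analytic_at (fun (_ : 'rV[R]_1) (_ : nilM Gam) => a) t0.
Proof.
have := analytic_at_poly Gam a%:P t0; congr (analytic_at _ t0).
by apply/funext => t; apply/funext => p; rewrite hornerC.
Qed.

Lemma kodaira_analytic (R : realType) (Gam : groupClosed (nilG R))
    (t0 : 'rV[R]_1) :
  analytic_mx_at (fun t => gac_Phi (kodaira_pair Gam (t 0 0))) t0.
Proof.
move=> i j; rewrite /=.
move: (kodaira_cplx R) (kodaira_form R) => K W.
pose M : 'M[{poly R}]_(5 + 5) := block_mx
  (\matrix_(i, j) ((1 - 'X ^+ 2) * (K i j)%:P))
  (\matrix_(i, j) ('X * (W j i)%:P))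
  (\matrix_(i, j) ((2%:P * 'X - 'X ^+ 3) * (W j i)%:P))
  (\matrix_(i, j) ((1 - 'X ^+ 2) * (- K j i)%:P)).
rewrite (_ : (fun (t : 'rV[R]_1) (p : nilM Gam) => _)
  = (fun (t : 'rV[R]_1) (p : nilM Gam) => (M i j).[t 0 0])).
  exact: analytic_at_poly.
apply/funext => t; apply/funext => p; rewrite /M.
case: (split_ordP i) => k ->; case: (split_ordP j) => l ->;
  rewrite ?(block_mxEul, block_mxEur, block_mxEdl, block_mxEdr) !mxE !hornerE;
  ring.
Qed.

(** * The deformation family *)

Theorem proposition5p2 (R : realType) (Gam : groupClosed (nilG R)) :
  discrete_subgroup Gam -> cocompact_subgroup Gam ->
  same_deformation_family (J1 Gam) (J0 Gam).
Proof.
move=> _ _.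
exists 1%N, setT, (fun t => gac_class (kodaira_pair Gam (t 0 0))); split.
- exact: openT.
- exact: connected_setT_rV1.
- move=> t _; exists (kodaira_pair Gam (t 0 0)); split=> //.
    exact: kodaira_pair_gac.
  exact: kodaira_courant_closed.
- move=> t0 _; exists (fun t => kodaira_pair Gam (t 0 0)); split.
  + apply: (@filterE _ (nbhs t0)) => t.
    by split=> //; exact: kodaira_pair_gac.
  + exact: kodaira_analytic.
  + by move=> i j; exact: analytic_at_cst.
  + by move=> i j; exact: analytic_at_cst.
exists (const_mx 1), (const_mx 0); split=> //; rewrite mxE /kodaira_pair.
  have -> : 2 * 1 - 1 ^+ 3 = 1 :> R by ring.
  by rewrite expr1n subrr scale0r !scale1r.
by rewrite !expr0n mulr0 !subr0 !scale0r scale1r.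
Qed.
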